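(* Let $h\in\mathbb{R}$, $\varrho\in(-1,1)$, $r=\frac{\varrho}{\sqrt{1-\varrho^2}}$ and $q=\frac12(1+r^2)h^2=\frac{h^2}{2(1-\varrho^2)}$. For $k\ge 0$ put $c_k=\frac{(2k)!!}{(2k+1)!!}\,Q(k+1,q)$. Then $$\Phi_\varrho^2(h,0)=\frac12\Phi(h)+\frac{r}{2\pi(1+r^2)}\sum_{k=0}^\infty c_k\left(\frac{r^2}{1+r^2}\right)^k=\frac12\Phi(h)+\frac{\sqrt{1-\varrho^2}}{2\pi}\sum_{k=0}^\infty c_k\,\varrho^{2k+1}.$$ The series $S=\sum_{k=0}^\infty c_k\left(\frac{r^2}{1+r^2}\right)^k$ converges for every $r,h\in\mathbb{R}$. If it is truncated after the $n$-th term, where $n\ge-1$ is an integer, then $$\Phi_\varrho^2(h,0)=\frac12\Phi(h)+\frac{r\,S_n}{2\pi(1+r^2)}+\mathrm{sgn}(r)\,R_n,$$ where $S_n=\sum_{k=0}^n c_k\left(\frac{r^2}{1+r^2}\right)^k$ and $R_n=\frac{|r|}{2\pi(1+r^2)}\sum_{k=n+1}^\infty c_k\left(\frac{r^2}{1+r^2}\right)^k$ is bounded by $$0\le R_n\le B_n,\qquad\text{where}\qquad B_n=\frac{(2n+2)!!}{(2n+3)!!}\,\frac{|r|}{2\pi}\left(\frac{r^2}{1+r^2}\right)^{n+1}.$$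
   Context: $\Phi(x)=\frac{1}{\sqrt{2\pi}}\int_{-\infty}^x e^{-t^2/2}\,\mathrm{d}t$ is the standard normal distribution function. For $\varrho\in(-1,1)$, the bivariate standard normal distribution function (the superscript $2$ is notation, not a power) is $$\Phi_\varrho^2(x,y)=\frac{1}{2\pi\sqrt{1-\varrho^2}}\int_{-\infty}^x\int_{-\infty}^y e^{-\frac{s^2-2\varrho st+t^2}{2(1-\varrho^2)}}\,\mathrm{d}s\,\mathrm{d}t.$$ For $a>0$, $x\ge0$, $Q(a,x)=\frac{1}{\Gamma(a)}\int_x^\infty t^{a-1}e^{-t}\,\mathrm{d}t$ is the upper regularized gamma function. $\mathrm{sgn}(x)=1$ if $x\ge0$ and $\mathrm{sgn}(x)=-1$ if $x<0$. Double factorials: $(2k)!!=2^kk!$ (so $0!!=1$), $(2k+1)!!=1\cdot3\cdots(2k+1)$. Empty sums are $0$ (so $S_{-1}=0$) and $0^0=1$ in power series. *)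

(* Defs.v *)
From HB Require Import structures.
From mathcomp Require Export all_boot all_order all_algebra.
From mathcomp Require Export all_classical all_reals all_analysis.

#[export] Set Implicit Arguments.
#[export] Unset Strict Implicit.
#[export] Unset Printing Implicit Defensive.

Export Order.TTheory GRing.Theory Num.Theory.
Export numFieldNormedType.Exports.

Local Open Scope classical_set_scope.
Local Open Scope ring_scope.

Definition Phi (R : realType) (x : R) : R :=
  (Num.sqrt (2 * pi))^-1 *
  \int[lebesgue_measure]_(t in `]-oo, x]) expR (- (t ^+ 2 / 2)).

(* The distribution function written $\Phi_\varrho^2(x,y)$: the 2 is the
   dimension, not an exponent. *)
Definition Phi2 (R : realType) (rho x y : R) : R :=
  (2 * pi * Num.sqrt (1 - rho ^+ 2))^-1 *
  \int[lebesgue_measure]_(t in `]-oo, x])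
    \int[lebesgue_measure]_(s in `]-oo, y])
      expR (- ((s ^+ 2 - 2 * rho * s * t + t ^+ 2) / (2 * (1 - rho ^+ 2)))).

Definition Gamma (R : realType) (a : R) : R :=
  \int[lebesgue_measure]_(t in `[0, +oo[) (t `^ (a - 1) * expR (- t)).

Definition Q (R : realType) (a x : R) : R :=
  (Gamma a)^-1 *
  \int[lebesgue_measure]_(t in `[x, +oo[) (t `^ (a - 1) * expR (- t)).

(* Unlike Num.sg, this takes the value 1 at 0. *)
Definition sgn (R : realType) (x : R) : R := if 0 <= x then 1 else -1.

(* n!!, i.e. (2k)!! = 2^k k! and (2k+1)!! = 1 * 3 * ... * (2k+1) *)
Definition dfact (n : nat) : nat :=
  (if odd n then \prod_(i < (n./2).+1) (2 * i + 1)
   else 2 ^ n./2 * (n./2)`!)%N.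

Definition coef (R : realType) (q : R) (k : nat) : R :=
  (dfact (2 * k))%:R / (dfact (2 * k + 1))%:R * Q k.+1%:R q.

(* Main.v *)
Require Import Defs.
From mathcomp Require Import measurable_realfun ring lra zify.

(* With g(t) = exp(-t^2/2) and G(x) the integral of g over ]-oo, x], completing
   the square gives 2 pi Phi2 rho h 0 = int_(t <= h) g(t) G(-rt). The function
   G - G(0) is the limit of g(x) sum_(k < n) x^(2k+1) / (2k+1)!!: the remainder
   has derivative g(x) x^(2n) / (2n-1)!!, so it has the sign of x (which makes
   the partial sums bounded by sqrt(2 pi)) and it vanishes as n grows, by the
   mean value theorem. Substituting x = -rt and integrating against g, dominated
   convergence yields the series: since Q(k+1, q) = exp(-q) sum_(j <= k) q^j/j!
   has derivative -exp(-q) q^k/k!, the k-th term integrates exactly to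
   r/(1+r^2) c_k (r^2/(1+r^2))^k, and the constant G(0) = sqrt(2 pi)/2
   contributes Phi(h)/2. As 0 <= Q <= 1 and the ratios (2k)!!/(2k+1)!! decrease,
   the tail is dominated by a geometric series. *)

Local Open Scope classical_set_scope.
Local Open Scope ring_scope.

(** * Integration over half-lines *)

Section integral_from_Ny.
Context {R : realType}.
Notation mu := (@lebesgue_measure R).

Lemma is_derive_continuous (f : R -> R) (x df : R) :
  is_derive x 1 f df -> {for x, continuous f}.
Proof.
by case=> dfx _; apply/differentiable_continuous/derivable1_diffP.
Qed.

Lemma dominated_cvg_Rintegral (D : set R) (f_ : nat -> R -> R) (f g : R -> R) :
  measurable D ->
  (forall n, measurable_fun D (f_ n)) ->
  (forall x, D x -> f_ n x @[n --> \oo] --> f x) ->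
  mu.-integrable D (EFin \o g) ->
  (forall n x, D x -> `|f_ n x| <= g x) ->
  \int[mu]_(x in D) f_ n x @[n --> \oo] --> \int[mu]_(x in D) f x.
Proof.
move=> mD mf_ f_f ig f_g.
have mf : measurable_fun D f by exact: (measurable_fun_cvg mf_).
have [] := @dominated_convergence _ _ _ mu D mD
  (fun n => EFin \o f_ n) (EFin \o f) (EFin \o g).
- by move=> n; apply/measurable_EFinP; exact: mf_.
- exact/measurable_EFinP.
- by apply: aeW => x Dx; apply: cvg_EFin; [exact: nearW|exact: f_f].
- exact: ig.
- by apply: aeW => x n Dx; rewrite /= lee_fin f_g.
move=> fi _ cf; apply: fine_cvg.
by rewrite fineK//; exact: integrable_fin_num.
Qed.

(** Dominated convergence with bound [|f|]: along any sequence tending to -oo, the restrictions of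
    [f] vanish eventually at each fixed point. *)
Lemma cvgNy_Rintegral (f : R -> R) : mu.-integrable setT (EFin \o f) ->
  \int[mu]_(t in `]-oo, x]) f t @[x --> -oo] --> (0 : R).
Proof.
move=> fi; apply/cvg_ninftyP => u uNy.
have mf : measurable_fun setT f.
  by apply/measurable_EFinP; exact: (measurable_int mu).
suff : \int[mu]_(t in setT) (f \_ `]-oo, u n]) t @[n --> \oo] -->
    \int[mu]_(t in setT) (cst 0 t).
  rewrite Rintegral_cst// mul0r.
  by apply: cvg_trans; apply: near_eq_cvg; near=> n; rewrite -Rintegral_mkcond.
apply: (@dominated_cvg_Rintegral _ _ _ (fun x => `|f x|)) => //.
- move=> n; apply/(measurable_restrictT _ _).1 => //.
  exact: measurable_funTS.
- move=> x _; apply: cvg_near_cst.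
  near=> n; apply/eqP; rewrite patchE ifF//.
  apply/negbTE; rewrite notin_setE/= in_itv/=; apply/negP; rewrite -ltNge.
  by near: n; move/cvgrNyPlt : uNy; exact.
- by move: fi => /integrable_abse; apply: eq_integrable.
- by move=> n x _; rewrite patchE; case: ifP => //; rewrite normr0.
Unshelve. all: by end_near. Qed.

Lemma is_derive_RintegralNy (f : R -> R) (x : R) :
  mu.-integrable setT (EFin \o f) -> continuous f ->
  is_derive x 1 (fun y => \int[mu]_(t in `]-oo, y]) f t) (f x).
Proof.
move=> fi cf.
(* The endpoint [x + 1] only serves to put [x] in the interior of the interval. *)
have [||||d1 d2] := @continuous_FTC1 R f -oo%O x (x + 1).
- by rewrite ltrDl.
- exact: integrableS fi.
- exact: ltNyr.
- exact: cf.
by apply: DeriveDef => //; rewrite -derive1E d2.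
Qed.

(** [F] and the integral up to [x] have the same derivative, so their difference is constant; its
    limit at -oo identifies it as [l]. Integrability replaces any sign condition on [f], as the
    integrands below may change sign. *)
Lemma FTC2Ny (f F : R -> R) (b l : R) :
  mu.-integrable setT (EFin \o f) -> continuous f ->
  (forall x : R, is_derive x 1 F (f x)) -> F x @[x --> -oo] --> l ->
  \int[mu]_(t in `]-oo, b]) f t = F b - l.
Proof.
move=> fi cf dF Fl.
pose G y := \int[mu]_(t in `]-oo, y]) f t.
have FG : forall x, F x - G x = F b - G b.
  move=> x; apply: (@is_derive_0_is_cst _ (F \- G) x b) => y.
  rewrite -(subrr (f y)); apply: is_deriveB.
  exact: is_derive_RintegralNy.
have : (F x - G x) @[x --> -oo] --> l - 0.
  by apply: cvgB => //; exact: cvgNy_Rintegral.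
under eq_fun do rewrite FG.
move=> /(cvg_unique _ (cvg_cst _)).
rewrite subr0 -/(G b) => <-; last exact: Rhausdorff.
by rewrite opprB subrKC.
Qed.

End integral_from_Ny.

(** * The Gaussian integral *)

Section gauss.
Context {R : realType}.
Notation mu := (@lebesgue_measure R).
Implicit Types x y t s m : R.

Definition gauss x : R := expR (- (x ^+ 2 / 2)).

Definition gauss_primitive x : R := \int[mu]_(t in `]-oo, x]) gauss t.

Lemma is_derive_expr n x :
  is_derive x 1 (fun y : R => y ^+ n) (n%:R * x ^+ n.-1).
Proof.
rewrite -[fun y => _]/(fun y : R => id y ^+ n) -exprfctE.
apply: (is_derive_eq (is_deriveX n (is_derive_id x (1 : R)))).
by rewrite /GRing.scale/= mulr1.
Qed.

Lemma is_derive_gauss x : is_derive x 1 gauss (- x * gauss x).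
Proof.
have h : is_derive x 1 (fun y : R => - (y ^+ 2 / 2)) (- x).
  have -> : (fun y : R => - (y ^+ 2 / 2)) = - 2^-1 *: (fun y : R => y ^+ 2).
    by apply/funext => y; rewrite scalrfctE /GRing.scale/=; ring.
  apply: (is_derive_eq (is_deriveZ _ (is_derive_expr 2 x))).
  by rewrite /GRing.scale/=; field.
by rewrite mulrC; exact: (is_derive1_comp (is_derive_expR _) h).
Qed.

Lemma gauss_gt0 x : 0 < gauss x. Proof. exact: expR_gt0. Qed.

Lemma gauss_le1 x : gauss x <= 1.
Proof. by rewrite expR_le1 oppr_le0 divr_ge0// sqr_ge0. Qed.

Lemma continuous_gauss : continuous gauss.
Proof.
move=> x; exact: is_derive_continuous (is_derive_gauss x).
Qed.

(** Link with the normal density, from which integrability and the total mass are inherited. A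
    general mean and scale are needed for the inner integral of [Phi2]. *)
Lemma gauss_affineE m s x : s != 0 ->
  gauss ((x - m) / s) = (normal_peak s)^-1 * normal_pdf m s x.
Proof.
move=> s0; rewrite normal_pdfE// mulKf ?gt_eqF ?normal_peak_gt0//.
by rewrite /gauss /normal_fun; congr expR; rewrite -mulr_natr; field.
Qed.

Lemma integrable_gauss_affine m s : s != 0 ->
  mu.-integrable setT (EFin \o (fun x => gauss ((x - m) / s))).
Proof.
move=> s0.
rewrite (_ : _ \o _ =
  fun x => ((normal_peak s)^-1%:E * (normal_pdf m s x)%:E)%E).
  by apply: integrableZl => //; exact: integrable_normal_pdf.
by apply/funext => x /=; rewrite gauss_affineE.
Qed.

Lemma gaussE x : gauss x = (normal_peak 1)^-1 * normal_pdf 0 1 x.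
Proof. by rewrite -gauss_affineE ?oner_eq0// subr0 divr1. Qed.

Lemma integrable_gauss : mu.-integrable setT (EFin \o gauss).
Proof.
have := integrable_gauss_affine 0 (oner_neq0 R).
by under eq_fun do rewrite subr0 divr1.
Qed.

Lemma integral_gauss : (\int[mu]_t (gauss t)%:E = (Num.sqrt (2 * pi))%:E)%E.
Proof.
under eq_integral do rewrite gaussE EFinM.
rewrite integralZl//; last exact: integrable_normal_pdf.
rewrite integral_normal_pdf mule1 /normal_peak invrK expr1n mul1r.
by rewrite -mulr_natl.
Qed.

Lemma is_derive_gauss_primitive x :
  is_derive x 1 gauss_primitive (gauss x).
Proof.
exact: is_derive_RintegralNy integrable_gauss continuous_gauss.
Qed.

Lemma cvg_gauss_primitiveNy : gauss_primitive x @[x --> -oo] --> (0 : R).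
Proof. exact: cvgNy_Rintegral integrable_gauss. Qed.

Lemma gauss_primitive_ge0 x : 0 <= gauss_primitive x.
Proof. by apply: Rintegral_ge0 => t _; exact/ltW/gauss_gt0. Qed.

Lemma gauss_primitive_le x : gauss_primitive x <= Num.sqrt (2 * pi).
Proof.
rewrite -lee_fin -integral_gauss fineK; last first.
  by apply: integrable_fin_num => //; exact: integrableS integrable_gauss.
apply: ge0_subset_integral => //.
- exact: (measurable_int mu integrable_gauss).
- by move=> t _; rewrite lee_fin; exact/ltW/gauss_gt0.
Qed.

(** As [gauss] is even, [t -> - t] moves the integral to [[0, +oo[], which carries half of the total
    mass. *)
Lemma gauss_primitive0 : gauss_primitive 0 = Num.sqrt (2 * pi) / 2.
Proof.
have sym t : gauss (- t) = gauss t by rewrite /gauss sqrrN.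
rewrite /gauss_primitive /Rintegral -[X in `]-oo, X]]oppr0.
rewrite ge0_integration_by_substitutionNy; last 2 first.
- by apply: continuous_subspaceT; exact: continuous_gauss.
- by move=> t _; exact/ltW/gauss_gt0.
rewrite (@eq_integral _ _ _ mu _ (EFin \o gauss)); last first.
  by move=> t _; rewrite /= sym.
have := integral_gauss; rewrite ge0_symfun_integralT; last 3 first.
- by move=> t; exact/ltW/gauss_gt0.
- exact: continuous_gauss.
- by move=> t; rewrite /= sym.
rewrite (_ : [set x | _] = `[0, +oo[%classic); last first.
  by apply/seteqP; split => x/=; rewrite in_itv/= andbT.
rewrite -[X in (_ * X)%E]fineK; last first.
  by apply: integrable_fin_num => //; exact: integrableS integrable_gauss.
by rewrite -EFinM => -[<-]; rewrite mulrAC divff ?mul1r.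
Qed.

End gauss.

(** * Expansion of the Gaussian integral *)

Lemma dfact_even k : dfact (2 * k) = (2 ^ k * k`!)%N.
Proof. by rewrite /dfact mul2n odd_double doubleK. Qed.

Lemma dfact_odd0 : dfact 1 = 1%N.
Proof. by rewrite /dfact/= big_ord_recl big_ord0. Qed.

Lemma dfact_oddS k : dfact (2 * k.+1 + 1) = (dfact (2 * k + 1) * (2 * k + 3))%N.
Proof.
have E m : dfact (2 * m + 1) = (\prod_(i < m.+1) (2 * i + 1))%N.
  by rewrite /dfact mul2n addn1 /= odd_double/= uphalf_double.
rewrite !E [LHS]big_ord_recr/=; congr (_ * _)%N; lia.
Qed.

Lemma dfact_gt0 n : (0 < dfact n)%N.
Proof.
rewrite /dfact; case: ifP => _; last by rewrite muln_gt0 expn_gt0 fact_gt0.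
by rewrite prodn_gt0// => i; rewrite addn1.
Qed.

(** Lets the remainder of the Gaussian expansion be compared with a term of the exponential series
    at [x ^+ 2]. *)
Lemma fact_le_dfact_odd n : ((2 * n + 1) * n`! <= dfact (2 * n + 1))%N.
Proof.
elim: n => [|n IH]; first by rewrite dfact_odd0.
rewrite dfact_oddS factS; nia.
Qed.

Section gauss_series.
Context {R : realType}.
Implicit Types x y t : R.

Lemma dfact_neq0 n : (dfact n)%:R != 0 :> R.
Proof. by rewrite pnatr_eq0 -lt0n dfact_gt0. Qed.

(** Covers both signs of [x] at once; of the location of [c], only the bound on its modulus is
    kept. *)
Lemma MVT_from0 (f df : R -> R) x : (forall y : R, is_derive y 1 f (df y)) ->
  exists2 c, `|c| <= `|x| & f x - f 0 = df c * x.
Proof.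
move=> fdf.
have cf (i : interval R) : {within [set` i], continuous f}.
  by apply: derivable_within_continuous => y _; have [] := fdf y.
have [x0|x0] := leP 0 x.
  have [c] := MVT_segment x0 (fun y _ => fdf y) (cf _).
  rewrite in_itv/= subr0 => /andP[c0 cx] e; exists c => //.
  by rewrite !ger0_norm.
have [c] := MVT_segment (ltW x0) (fun y _ => fdf y) (cf _).
rewrite in_itv/= => /andP[cx c0] e; exists c.
  by rewrite !ler0_norm ?lerN2// ltW.
by rewrite -opprB e sub0r mulrN opprK.
Qed.

Definition gauss_sum n x : R :=
  gauss x * \sum_(k < n) x ^+ (2 * k + 1) / (dfact (2 * k + 1))%:R.

(** The derivatives of the terms telescope: the k-th one gives $g(x)(x^{2k}/(2k-1)!! -
    x^{2k+2}/(2k+1)!!)$. Writing $1/(2n-1)!!$ as $(2n+1)/(2n+1)!!$ avoids $(-1)!!$ at $n = 0$. *)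
Lemma is_derive_gauss_remainder n x :
  is_derive x 1 (fun y => gauss_primitive y - gauss_primitive 0 - gauss_sum n y)
    (gauss x * (x ^+ (2 * n) * (2 * n + 1)%:R / (dfact (2 * n + 1))%:R)).
Proof.
elim: n => [|n IH].
  have -> : (fun y => gauss_primitive y - gauss_primitive 0 - gauss_sum 0 y) =
      gauss_primitive - cst (gauss_primitive 0).
    by apply/funext => y; rewrite /gauss_sum big_ord0 mulr0 subr0.
  apply: (is_derive_eq (is_deriveB (is_derive_gauss_primitive x)
    (is_derive_cst _ _ _))).
  by rewrite dfact_odd0 subr0 expr0 mul1r mulfV ?mulr1.
pose a : R := (dfact (2 * n + 1))%:R.
pose T y := gauss y * y ^+ (2 * n + 1).
have -> : (fun y => gauss_primitive y - gauss_primitive 0 - gauss_sum n.+1 y) =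
   (fun y => gauss_primitive y - gauss_primitive 0 - gauss_sum n y) - a^-1 *: T.
  apply/funext => y; rewrite !fctE /gauss_sum big_ord_recr/= mulrDr /T -/a.
  by rewrite /GRing.scale/=; ring.
have dT : is_derive x 1 T
    (gauss x * ((2 * n + 1)%:R * x ^+ (2 * n) - x ^+ (2 * n + 2))).
  apply: (is_derive_eq (is_deriveM (is_derive_gauss x)
    (is_derive_expr (2 * n + 1) x))).
  rewrite /GRing.scale/= (_ : (2 * n + 1).-1 = (2 * n)%N); last lia.
  by rewrite (_ : 2 * n + 2 = (2 * n + 1).+1)%N; [rewrite exprS; ring|lia].
apply: (is_derive_eq (is_deriveB IH (is_deriveZ a^-1 dT))).
rewrite dfact_oddS natrM -/a (_ : 2 * n.+1 + 1 = 2 * n + 3)%N; last lia.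
rewrite (_ : 2 * n.+1 = 2 * n + 2)%N; last lia.
rewrite /GRing.scale/=; field.
by rewrite dfact_neq0 -natrM -natrD pnatr_eq0 addn3.
Qed.

Lemma gauss_sum0 n : gauss_sum n 0 = 0.
Proof.
rewrite /gauss_sum big1 ?mulr0// => i _.
by rewrite expr0n addn1/= mul0r.
Qed.

Lemma gauss_remainder n x : exists2 c, `|c| <= `|x| &
  gauss_primitive x - gauss_primitive 0 - gauss_sum n x =
  gauss c * (c ^+ (2 * n) * (2 * n + 1)%:R / (dfact (2 * n + 1))%:R) * x.
Proof.
have [c cx e] := MVT_from0 x (is_derive_gauss_remainder n).
by exists c => //; rewrite -e gauss_sum0 !subrr subr0.
Qed.

(** The partial sum and the remainder are both nonnegative multiples of [x], so the sum is at most
    their total in modulus, a difference of two values in $[0, \sqrt{2\pi}]$. Being uniform in [n]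
    and [x], the bound serves for dominated convergence. *)
Lemma gauss_sum_bound n x : `|gauss_sum n x| <= Num.sqrt (2 * pi).
Proof.
have [c _ e] := gauss_remainder n x.
set d := gauss c * _ in e.
have d0 : 0 <= d.
  rewrite mulr_ge0 ?(ltW (gauss_gt0 _))// mulr_ge0 ?invr_ge0// mulr_ge0//.
  by rewrite exprM exprn_ge0 ?sqr_ge0.
(* Taking one factor [x] out leaves only even powers, hence a nonnegative cofactor. *)
have [p p0 ep] : exists2 p, 0 <= p & gauss_sum n x = p * x.
  exists (gauss x * \sum_(k < n) x ^+ (2 * k) / (dfact (2 * k + 1))%:R).
    rewrite mulr_ge0 ?sumr_ge0// ?(ltW (gauss_gt0 _))// => i _.
    by rewrite mulr_ge0 ?invr_ge0// exprM exprn_ge0 ?sqr_ge0.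
  rewrite /gauss_sum -mulrA mulr_suml; congr (_ * _); apply: eq_bigr => i _.
  by rewrite addn1 exprSr mulrAC.
have {e}e : gauss_primitive x - gauss_primitive 0 = (d + p) * x.
  by rewrite mulrDl -e -ep subrK.
apply: (@le_trans _ _ `|gauss_primitive x - gauss_primitive 0|).
  rewrite e ep !normrM ler_wpM2r// !ger0_norm ?addr_ge0//.
  by rewrite lerDr.
have := gauss_primitive_le x; have := gauss_primitive_le (0 : R).
have := gauss_primitive_ge0 x; have := gauss_primitive_ge0 (0 : R).
by move=> *; rewrite ler_norml; lra.
Qed.

(** The mean value form bounds the remainder by $|x|\,(x^2)^n/n!$, and the terms of an exponential
    series tend to 0. *)
Lemma cvg_gauss_sum x :
  gauss_sum n x @[n --> \oo] --> gauss_primitive x - gauss_primitive 0.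
Proof.
apply/subr_cvg0; apply: norm_cvg0.
apply: (@squeeze_cvgr _ _ _ _ (cst 0) (fun n => `|x| * exp_coeff (x ^+ 2) n)).
- near=> n; rewrite normr_ge0/= distrC.
  have [c cx ->] := gauss_remainder n x.
  rewrite normrM mulrC ler_wpM2l// normrM ger0_norm ?(ltW (gauss_gt0 _))//.
  rewrite -[leRHS]mul1r ler_pM ?(ltW (gauss_gt0 _)) ?gauss_le1//.
  have c2n : 0 <= c ^+ (2 * n) by rewrite exprM exprn_ge0// sqr_ge0.
  rewrite normrM normrM exp_coeffE mulrC (ger0_norm c2n).
  rewrite !ger0_norm ?invr_ge0// !exprM.
  rewrite mulrCA mulrC ler_pM ?(exprn_ge0 _ (sqr_ge0 _))?divr_ge0//; last first.
    rewrite lerXn2r ?nnegrE ?sqr_ge0//.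
    by rewrite -(real_normK (num_real c)) -(real_normK (num_real x)) lerXn2r ?nnegrE.
  rewrite mulrC ler_pdivrMr ?ltr0n ?dfact_gt0// mulrC.
  rewrite ler_pdivlMr ?ltr0n ?fact_gt0//.
  by rewrite -natrM ler_nat fact_le_dfact_odd.
- exact: cvg_cst.
- rewrite -[X in _ --> X](mulr0 `|x|); apply: cvgM; first exact: cvg_cst.
  exact: cvg_exp_coeff.
Unshelve. all: by end_near. Qed.

(** Read off from the differentiability of the remainder and of [gauss_primitive], without treating
    the sum term by term. *)
Lemma continuous_gauss_sum n : continuous (gauss_sum n).
Proof.
move=> x; apply/differentiable_continuous/derivable1_diffP.
have [d _] := is_derive_gauss_remainder n x.
have -> : gauss_sum n = (gauss_primitive - cst (gauss_primitive 0)) -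
   (fun y => gauss_primitive y - gauss_primitive 0 - gauss_sum n y).
  by apply/funext => y; rewrite !fctE; ring.
apply: derivableB => //; apply: derivableB => //.
by have [] := is_derive_gauss_primitive x.
Qed.

End gauss_series.

(** * The coefficients of the series *)

Section exp_trunc.
Context {R : realType}.
Notation mu := (@lebesgue_measure R).
Implicit Types x y t q : R.

(** Closed form of $Q(k+1, x)$ for $x \ge 0$, polynomial times exponential. *)
Definition exp_trunc k x : R :=
  expR (- x) * \sum_(j < k.+1) x ^+ j / j`!%:R.

Lemma exp_trunc0 x : exp_trunc 0 x = expR (- x).
Proof. by rewrite /exp_trunc big_ord1 expr0 fact0 divr1 mulr1. Qed.

Lemma exp_truncS k x :
  exp_trunc k.+1 x = exp_trunc k x + expR (- x) * x ^+ k.+1 / k.+1`!%:R.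
Proof. by rewrite /exp_trunc big_ord_recr/= mulrDr mulrA. Qed.

Lemma is_derive_expRN x :
  is_derive x 1 (fun y : R => expR (- y)) (- expR (- x)).
Proof.
apply: (is_derive_eq (is_derive1_comp (is_derive_expR (- x))
  (is_deriveN (is_derive_id x (1 : R))))).
by rewrite mulrN mulr1.
Qed.

Lemma is_derive_exp_trunc k x :
  is_derive x 1 (exp_trunc k) (- (expR (- x) * x ^+ k / k`!%:R)).
Proof.
elim: k => [|k IH].
  rewrite (_ : exp_trunc 0 = fun y => expR (- y)); last first.
    by apply/funext => y; rewrite exp_trunc0.
  apply: (is_derive_eq (is_derive_expRN x)).
  by rewrite expr0 fact0 mulr1 divr1.
rewrite (_ : exp_trunc k.+1 = exp_trunc k +
  (k.+1`!%:R^-1) *: ((fun y => expR (- y)) * (fun y => y ^+ k.+1))); last first.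
  by apply/funext => y; rewrite exp_truncS !fctE /GRing.scale/= mulrC.
apply: (is_derive_eq (is_deriveD IH (is_deriveZ _
  (is_deriveM (is_derive_expRN x) (is_derive_expr k.+1 x))))).
have k0 : (k`!%:R : R) != 0 by rewrite pnatr_eq0 -lt0n fact_gt0.
rewrite /GRing.scale/= factS natrM; field.
by rewrite k0 (addrC 1) natr1 pnatr_eq0.
Qed.

Lemma exp_trunc_ge0 k x : 0 <= x -> 0 <= exp_trunc k x.
Proof.
move=> x0; rewrite mulr_ge0 ?expR_ge0// sumr_ge0// => i _.
by rewrite divr_ge0// exprn_ge0.
Qed.

Lemma exp_trunc_at0 k : exp_trunc k 0 = 1.
Proof.
elim: k => [|k IH]; first by rewrite exp_trunc0 oppr0 expR0.
by rewrite exp_truncS IH expr0n/= mulr0 mul0r addr0.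
Qed.

(** The derivative is nonpositive on the nonnegative half-line, and the value at 0 is 1. *)
Lemma exp_trunc_le1 k x : 0 <= x -> exp_trunc k x <= 1.
Proof.
move=> x0; rewrite -(exp_trunc_at0 k) -subr_le0.
have cf (i : interval R) : {within [set` i], continuous (exp_trunc k)}.
  apply: derivable_within_continuous => y _.
  by have [] := is_derive_exp_trunc k y.
have [c] := MVT_segment x0 (fun y _ => is_derive_exp_trunc k y) (cf _).
rewrite in_itv/= => /andP[c0 _] ->.
by rewrite subr0 mulNr oppr_le0 !mulr_ge0 ?expR_ge0 ?invr_ge0 ?exprn_ge0.
Qed.

Lemma cvg_expRN_exprn k : expR (- x) * x ^+ k @[x --> +oo] --> (0 : R).
Proof.
apply: (@squeeze_cvgr _ _ _ _ (cst 0) (fun x => k.+1`!%:R * x^-1)).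
(* Since $e^x \ge x^{k+1}/(k+1)!$, the product is at most $(k+1)!/x$. *)
- near=> x; have x0 : 0 < x by near: x; exact: nbhs_pinfty_gt.
  rewrite mulr_ge0 ?expR_ge0 ?exprn_ge0 ?(ltW x0)//=.
  rewrite ler_pdivlMr// expRN -mulrA -exprSr ler_pdivrMl ?expR_gt0//.
  rewrite -ler_pdivrMr ?ltr0n ?fact_gt0//.
  by apply: le_trans (expR_ge1Dxn k (ltW x0)); rewrite lerDr.
- exact: cvg_cst.
- rewrite -[X in _ --> X](mulr0 k.+1`!%:R); apply: cvgM; first exact: cvg_cst.
  apply/gtr0_cvgV0; last exact: cvg_id.
  exact: nbhs_pinfty_gt.
Unshelve. all: by end_near. Qed.

Lemma cvg_exp_trunc k : exp_trunc k x @[x --> +oo] --> (0 : R).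
Proof.
elim: k => [|k IH].
  by have -> : exp_trunc 0 = fun y => expR (- y);
    [apply/funext => y; rewrite exp_trunc0|exact: cvgr_expR].
have -> : exp_trunc k.+1 =
    fun y => exp_trunc k y + expR (- y) * y ^+ k.+1 / k.+1`!%:R.
  by apply/funext => y; rewrite exp_truncS.
rewrite -[X in _ --> X](addr0 0); apply: cvgD => //.
rewrite -[X in _ --> X](mul0r k.+1`!%:R^-1).
by apply: cvgM; [exact: cvg_expRN_exprn|exact: cvg_cst].
Qed.

(** By its derivative, [- k! * exp_trunc k] is a primitive of $e^{-t} t^k$, and it vanishes at +oo.
    Nonnegativity of [x] makes the real power [powR] agree with the natural one. *)
Lemma integral_gamma k x : 0 <= x ->
  \int[mu]_(t in `[x, +oo[) (t `^ (k.+1%:R - 1) * expR (- t)) =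
  k`!%:R * exp_trunc k x.
Proof.
move=> x0; have k0 : (k`!%:R : R) != 0 by rewrite pnatr_eq0 -lt0n fact_gt0.
rewrite (@eq_Rintegral _ _ _ mu _ (fun t => expR (- t) * t ^+ k)); last first.
  move=> t; rewrite inE/= in_itv/= andbT => xt.
  by rewrite -natr1 addrK powR_mulrn ?(le_trans x0)// mulrC.
have dF (t : R) : is_derive t 1 (- k`!%:R *: exp_trunc k) (expR (- t) * t ^+ k).
  apply: (is_derive_eq (is_deriveZ _ (is_derive_exp_trunc k t))).
  by rewrite /GRing.scale/=; field.
have cf : continuous (fun t : R => expR (- t) * t ^+ k).
  move=> t; apply: cvgM; last exact: exprn_continuous.
  exact: is_derive_continuous (is_derive_expRN t).
rewrite (@Rintegral_ge0_continuous_FTC2y _ _ (- k`!%:R *: exp_trunc k) x 0).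
- by rewrite scalrfctE /GRing.scale/=; ring.
- by move=> t xt; rewrite mulr_ge0 ?expR_ge0 ?exprn_ge0// (le_trans x0).
- exact: continuous_subspaceT.
- rewrite -[X in _ --> X](mulr0 (- k`!%:R)).
  by apply: cvgM; [exact: cvg_cst|exact: cvg_exp_trunc].
- by move=> t _; have [] := dF t.
- apply: cvg_at_right_filter.
  exact: is_derive_continuous (dF x).
- by move=> t _; rewrite derive1E; have [] := dF t.
Qed.

Lemma Gamma_natE k : Gamma (k.+1%:R : R) = k`!%:R.
Proof. by rewrite /Gamma integral_gamma// exp_trunc_at0 mulr1. Qed.

Lemma coefE q k : 0 <= q ->
  coef q k = (dfact (2 * k))%:R / (dfact (2 * k + 1))%:R * exp_trunc k q.
Proof.
by move=> q0; rewrite /coef /Q Gamma_natE integral_gamma// mulKf.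
Qed.

(** Passing from [n] to [n + 1] multiplies the ratio by $(2n+2)/(2n+3) < 1$. *)
Lemma dfact_ratio_antitone m n : (m <= n)%N ->
  (dfact (2 * n))%:R / (dfact (2 * n + 1))%:R <=
  (dfact (2 * m))%:R / (dfact (2 * m + 1))%:R :> R.
Proof.
elim: n => [|n IH]; first by rewrite leqn0 => /eqP ->.
rewrite leq_eqVlt => /predU1P[->//|/IH]; apply: le_trans.
rewrite ler_pdivrMr ?ltr0n ?dfact_gt0// mulrAC ler_pdivlMr ?ltr0n ?dfact_gt0//.
rewrite -!natrM ler_nat dfact_oddS !dfact_even factS expnS.
have := dfact_gt0 (2 * n + 1); nia.
Qed.

Lemma coef_ge0 q k : 0 <= q -> 0 <= coef q k.
Proof. by move=> q0; rewrite coefE// mulr_ge0 ?divr_ge0 ?exp_trunc_ge0. Qed.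

(** One constant, depending on [m] alone, for the whole tail: this is what makes the tail
    geometric. *)
Lemma coef_le q m n : 0 <= q -> (m <= n)%N ->
  coef q n <= (dfact (2 * m))%:R / (dfact (2 * m + 1))%:R.
Proof.
move=> q0 mn; rewrite coefE//; apply: le_trans (dfact_ratio_antitone mn).
by rewrite ler_piMr ?exp_trunc_le1// divr_ge0.
Qed.

End exp_trunc.

(** * The bivariate distribution function *)

Section bivariate.
Context {R : realType}.
Notation mu := (@lebesgue_measure R).
Implicit Types r h t x q rho : R.

Lemma integrable_gaussM (f : R -> R) (M : R) : continuous f ->
  (forall t, `|f t| <= M) ->
  mu.-integrable setT (EFin \o (fun t => gauss t * f t)).
Proof.
move=> cf fM.
apply: (@le_integrable _ _ R mu setT measurableT _
    (fun t => (M%:E * (gauss t)%:E)%E)).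
- apply/measurable_EFinP; apply: continuous_measurable_fun => t.
  by apply: cvgM; [exact: continuous_gauss|exact: cf].
- move=> t _; rewrite /= lee_fin !normrM mulrC ler_wpM2r//.
  exact: le_trans (fM t) (ler_norm _).
- by apply: integrableZl => //; exact: integrable_gauss.
Qed.

Lemma continuous_gauss_primitive : continuous (@gauss_primitive R).
Proof.
by move=> x; exact: is_derive_continuous (is_derive_gauss_primitive x).
Qed.

Lemma continuous_opprM r : continuous (fun t => - (r * t)).
Proof.
move=> t; apply: (@cvgN _ R^o).
by apply: (@cvgM R); [exact: cvg_cst|exact: cvg_id].
Qed.

Lemma PhiE h : Phi h = (Num.sqrt (2 * pi))^-1 * gauss_primitive h.
Proof. by []. Qed.

Lemma integrable_gaussM_primitive r :
  mu.-integrable setT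
    (EFin \o (fun t => gauss t * gauss_primitive (- (r * t)))).
Proof.
apply: (@integrable_gaussM _ (Num.sqrt (2 * pi))).
  move=> t; apply: (@continuous_comp _ _ _
    (fun t => - (r * t)) gauss_primitive).
    exact: continuous_opprM.
  exact: continuous_gauss_primitive.
by move=> t; rewrite ger0_norm ?gauss_primitive_ge0 ?gauss_primitive_le.
Qed.

(** Completing the square in the inner variable separates a factor [gauss t] from a Gaussian of mean
    [rho * t] and scale [s], whose integral up to 0 is explicit. *)
Lemma Phi2_0E rho h : -1 < rho < 1 ->
  Phi2 rho h 0 = (2 * pi)^-1 * \int[mu]_(t in `]-oo, h])
    (gauss t * gauss_primitive (- (rho / Num.sqrt (1 - rho ^+ 2) * t))).
Proof.
move=> /andP[rho1 rho2].
have rr : 0 < 1 - rho ^+ 2 by nra.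
rewrite /Phi2; set s := Num.sqrt _.
have s2 : s ^+ 2 = 1 - rho ^+ 2 by rewrite sqr_sqrtr// ltW.
have s0 : 0 < s by rewrite sqrtr_gt0.
have inner t : \int[mu]_(y in `]-oo, 0])
      expR (- ((y ^+ 2 - 2 * rho * y * t + t ^+ 2) / (2 * (1 - rho ^+ 2)))) =
    s * (gauss t * gauss_primitive (- (rho / s * t))).
  (* $y^2 - 2\varrho yt + t^2 = (y - \varrho t)^2 + (1-\varrho^2) t^2$, with $1-\varrho^2 = s^2$. *)
  rewrite (@eq_Rintegral _ _ _ mu _
    (fun y => gauss t * gauss ((y - rho * t) / s))); last first.
    move=> y _; rewrite /gauss -expRD; congr expR.
    by field: s2; rewrite ?lt0r_neq0.
  pose f y := gauss t * gauss ((y - rho * t) / s).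
  pose F y := s * gauss t * gauss_primitive ((y - rho * t) / s).
  have dF (y : R) : is_derive y 1 F (f y).
    have d : is_derive y 1 (fun y => (y - rho * t) / s) s^-1.
      have -> : (fun y => (y - rho * t) / s) = s^-1 *: (id - cst (rho * t)).
        by apply/funext => z; rewrite !fctE /GRing.scale/= mulrC.
      apply: (is_derive_eq (is_deriveZ _
        (is_deriveB (is_derive_id y (1 : R)) (is_derive_cst _ _ _)))).
      by rewrite /GRing.scale/= subr0 mulr1.
    apply: (is_derive_eq (is_deriveZ (s * gauss t)
      (is_derive1_comp (is_derive_gauss_primitive _) d))).
    by rewrite /GRing.scale/= /f; field; rewrite gt_eqF.
  have fi : mu.-integrable setT (EFin \o f).
    rewrite (_ : _ \o _ =
      fun y => ((gauss t)%:E * (gauss ((y - rho * t) / s))%:E)%E)//.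
    apply: integrableZl => //.
    by apply: integrable_gauss_affine; rewrite gt_eqF.
  have cf : continuous f.
    move=> y; apply: (@cvgM R); first exact: cvg_cst.
    apply: (@continuous_comp _ _ _ (fun y => (y - rho * t) / s) gauss);
      last exact: continuous_gauss.
    apply: (@cvgM R); last exact: cvg_cst.
    by apply: (@cvgB _ R^o); [exact: cvg_id|exact: cvg_cst].
  have F0 : F y @[y --> -oo] --> (0 : R).
    rewrite -[X in _ --> X](mulr0 (s * gauss t)).
    apply: (@cvgM R); first exact: cvg_cst.
    apply: (@cvg_comp _ _ _ (fun y => (y - rho * t) / s) gauss_primitive);
      last exact: cvg_gauss_primitiveNy.
    by apply: gt0_cvgMlNy; [rewrite invr_gt0|exact: cvg_addrr_Ny].
  rewrite (FTC2Ny 0 fi cf dF F0) /F subr0 sub0r -mulrA.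
  by congr (_ * (_ * gauss_primitive _)); ring.
rewrite (@eq_Rintegral _ _ _ mu _
  (fun t => s * (gauss t * gauss_primitive (- (rho / s * t))))); last first.
  by move=> t _; rewrite inner.
rewrite RintegralZl//; last first.
  by apply: integrableS (integrable_gaussM_primitive _).
(* The scale [s] cancels the square root in the normalization of [Phi2]. *)
by rewrite mulrA invfM mulfVK// gt_eqF.
Qed.

End bivariate.

(** * Termwise integration against the Gaussian weight *)

Section expansion.
Context {R : realType}.
Notation mu := (@lebesgue_measure R).
Implicit Types r h t x q rho : R.

Lemma integrable_gaussM_sum r n :
  mu.-integrable setT (EFin \o (fun t => gauss t * gauss_sum n (- (r * t)))).
Proof.
apply: (@integrable_gaussM _ _ (Num.sqrt (2 * pi))).
  move=> t; apply: (@continuous_comp _ _ _ (fun t => - (r * t)) (gauss_sum n)).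
    exact: continuous_opprM.
  exact: continuous_gauss_sum.
by move=> t; exact: gauss_sum_bound.
Qed.

(** An explicit primitive [F] is a combination of the [exp_trunc k] at [q t]. It vanishes at -oo
    because [q t] tends to +oo there, so only the value at [h] remains. *)
Lemma integral_gaussM_sum r h n (q := fun t => 2^-1 * (1 + r ^+ 2) * t ^+ 2) :
  \int[mu]_(t in `]-oo, h]) (gauss t * gauss_sum n (- (r * t))) =
  r / (1 + r ^+ 2) *
    \sum_(0 <= k < n) coef (q h) k * (r ^+ 2 / (1 + r ^+ 2)) ^+ k.
Proof.
have a0 : 0 < 1 + r ^+ 2 by rewrite ltr_pwDl// sqr_ge0.
pose c k : R := r / (1 + r ^+ 2) *
  ((dfact (2 * k))%:R / (dfact (2 * k + 1))%:R * (r ^+ 2 / (1 + r ^+ 2)) ^+ k).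
pose F : R -> R := \sum_(k < n) c k *: (exp_trunc k \o q).
have dq (t : R) : is_derive t 1 q ((1 + r ^+ 2) * t).
  have -> : q = (2^-1 * (1 + r ^+ 2)) *: (fun t => t ^+ 2) by [].
  apply: (is_derive_eq (is_deriveZ _ (is_derive_expr 2 t))).
  by rewrite /GRing.scale/=; field.
have dF (t : R) : is_derive t 1 F (gauss t * gauss_sum n (- (r * t))).
  apply: (is_derive_eq (is_derive_sum (fun k : 'I_n => is_deriveZ (c k)
    (is_derive1_comp (is_derive_exp_trunc k (q t)) (dq t))))).
  rewrite /gauss_sum mulrA mulr_sumr; apply: eq_bigr => k _.
  have -> : gauss t * gauss (- (r * t)) = expR (- q t).
    by rewrite /gauss -expRD /q; congr expR; field.
  rewrite /GRing.scale/= /c dfact_even natrM natrX.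
  have -> : (- (r * t)) ^+ (2 * k + 1) = - (r * t) * (r ^+ 2 * t ^+ 2) ^+ k.
    by rewrite addn1 exprS exprM; congr (_ * _ ^+ _); ring.
  (* Even powers of [r * t] become powers of [q t]; the resulting $2^k$ and the $k!$ from
     [exp_trunc] are absorbed by $(2k)!! = 2^k k!$. *)
  rewrite (_ : r ^+ 2 * t ^+ 2 = 2 * (r ^+ 2 / (1 + r ^+ 2)) * q t); last first.
    by rewrite /q; field; rewrite gt_eqF.
  rewrite !exprMn; field.
  by rewrite dfact_neq0 pnatr_eq0 -lt0n fact_gt0 gt_eqF.
have cf : continuous (fun t => gauss t * gauss_sum n (- (r * t))).
  move=> t; apply: (@cvgM R); first exact: continuous_gauss.
  apply: (@continuous_comp _ _ _ (fun t => - (r * t)) (gauss_sum n)).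
    exact: continuous_opprM.
  exact: continuous_gauss_sum.
have qy : q t @[t --> -oo] --> +oo.
  (* As [q] is even, its limit at -oo is its limit at +oo. *)
  apply/cvgNy_compNP; rewrite (_ : q \o -%R = q); last first.
    by apply/funext => t; rewrite /q/= sqrrN.
  by apply: gt0_cvgMry; [rewrite mulr_gt0|exact: cvgr_expr2].
have F0 : F t @[t --> -oo] --> (0 : R).
  rewrite (_ : F = fun t => \sum_(k < n) c k * exp_trunc k (q t)); last first.
    by apply/funext => t; rewrite /F fct_sumE.
  have c0 : \sum_(k < n) c k * 0 = 0 by rewrite big1// => k _; rewrite mulr0.
  rewrite -[X in _ --> X]c0.
  apply: cvg_big => [|k _]; first exact: add_continuous.
  apply: (@cvgM R); first exact: cvg_cst.
  apply: (@cvg_comp _ _ _ q (exp_trunc k) _ +oo); first exact: qy.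
  exact: cvg_exp_trunc.
rewrite (FTC2Ny h (integrable_gaussM_sum r n) cf dF F0) subr0 /F fct_sumE.
rewrite big_mkord mulr_sumr; apply: eq_bigr => k _.
rewrite coefE; last by rewrite mulr_ge0 ?sqr_ge0// mulr_ge0// ltW.
by rewrite scalrfctE /GRing.scale/= /c /q; ring.
Qed.

(** Dominated convergence under $\sqrt{2\pi}\,g$. The pointwise limit contains $-G(0)$, whose
    integral against the weight is the subtracted product. *)
Lemma cvg_integral_gaussM_sum r h :
  \int[mu]_(t in `]-oo, h]) (gauss t * gauss_sum n (- (r * t))) @[n --> \oo] -->
  \int[mu]_(t in `]-oo, h]) (gauss t * gauss_primitive (- (r * t))) -
  gauss_primitive 0 * gauss_primitive h.
Proof.
have gi := @integrable_gauss R.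
have gp := integrable_gaussM_primitive r.
rewrite /(gauss_primitive h) -RintegralZl//; last exact: integrableS gi.
rewrite -RintegralB//; last 2 first.
- exact: integrableS gp.
- rewrite (_ : _ \o _ = fun t => ((gauss_primitive 0)%:E * (gauss t)%:E)%E)//.
  by apply: integrableZl => //; exact: integrableS gi.
apply: (@dominated_cvg_Rintegral _ _ _ _
  (fun t => Num.sqrt (2 * pi) * gauss t)).
- by [].
- move=> n; apply: measurable_funTS; apply/measurable_EFinP.
  exact: (measurable_int mu (integrable_gaussM_sum r n)).
- move=> t _; rewrite (mulrC (gauss_primitive 0)) -mulrBr.
  by apply: (@cvgM R); [exact: cvg_cst|exact: cvg_gauss_sum].
- rewrite (_ : _ \o _ = fun t => ((Num.sqrt (2 * pi))%:E * (gauss t)%:E)%E)//.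
  by apply: integrableZl => //; exact: integrableS gi.
- move=> n t _; rewrite normrM mulrC (ger0_norm (ltW (gauss_gt0 _))).
  by rewrite ler_wpM2r ?(ltW (gauss_gt0 _))// gauss_sum_bound.
Qed.

End expansion.

(** * Convergence and truncation of the series *)

Section series_tail.
Context {R : realType}.

Lemma cvg_series_tail (u : nat -> R) m : cvgn (series u) ->
  \sum_(m <= k < N) u k @[N --> \oo] -->
  limn (series u) - \sum_(0 <= k < m) u k.
Proof.
move=> cu.
have : series u N - series u m @[N --> \oo] --> limn (series u) - series u m.
  by apply: cvgB => //; exact: cvg_cst.
apply: cvg_trans; apply: near_eq_cvg; near=> N.
by rewrite sub_series_geq//; near: N; exact: nbhs_infty_ge.
Unshelve. all: by end_near. Qed.

Lemma geometric_tailE (x : R) m N : (m <= N)%N ->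
  (\sum_(m <= k < N) x ^+ k) * (1 - x) = x ^+ m - x ^+ N.
Proof.
elim: N => [|N IH].
  by rewrite leqn0 => /eqP->; rewrite big_geq// mul0r subrr.
rewrite leq_eqVlt => /predU1P[->|mN]; first by rewrite big_geq// mul0r subrr.
by rewrite big_nat_recr//= mulrDl IH// exprS; ring.
Qed.

(** Each finite tail is at most $a(x^m - x^N)/(1-x)$; dropping $x^N$ gives a bound free of [N] that
    passes to the limit. *)
Lemma series_tail_bound (u : nat -> R) (a x : R) m : 0 <= a -> 0 <= x < 1 ->
  (forall k, 0 <= u k) -> (forall k, (m <= k)%N -> u k <= a * x ^+ k) ->
  cvgn (series u) ->
  0 <= limn (fun N => \sum_(m <= k < N) u k) <= a * x ^+ m / (1 - x).
Proof.
move=> a0 /andP[x0 x1] u0 ux cu.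
have ct := cvgP _ (cvg_series_tail (m := m) cu).
apply/andP; split.
  by apply: limr_ge => //; apply: nearW => N; exact: sumr_ge0.
apply: limr_le => //; near=> N.
have mN : (m <= N)%N by near: N; exact: nbhs_infty_ge.
apply: (@le_trans _ _ (a * \sum_(m <= k < N) x ^+ k)).
  rewrite mulr_sumr big_nat_cond [leRHS]big_nat_cond; apply: ler_sum => k.
  by rewrite andbT => /andP[mk _]; exact: ux.
rewrite ler_pdivlMr ?subr_gt0// -mulrA ler_wpM2l// geometric_tailE//.
by rewrite lerBlDr lerDl exprn_ge0.
Unshelve. all: by end_near. Qed.

End series_tail.

(** * Convergence of the expansion and identification of its sum *)

Section expansion_convergence.
Context {R : realType}.
Implicit Types r h q : R.

Lemma ratio_itv r : 0 <= r ^+ 2 / (1 + r ^+ 2) < 1.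
Proof.
have a0 : 0 < 1 + r ^+ 2 by rewrite ltr_pwDl// sqr_ge0.
by rewrite divr_ge0 ?sqr_ge0 ?(ltW a0)//= ltr_pdivrMr// mul1r ltrDr.
Qed.

Lemma expansion_term_ge0 r q k : 0 <= q ->
  0 <= coef q k * (r ^+ 2 / (1 + r ^+ 2)) ^+ k.
Proof.
have /andP[x0 _] := ratio_itv r.
by move=> q0; rewrite mulr_ge0 ?coef_ge0 ?exprn_ge0.
Qed.

Lemma expansion_term_le r q m k : 0 <= q -> (m <= k)%N ->
  coef q k * (r ^+ 2 / (1 + r ^+ 2)) ^+ k <=
  (dfact (2 * m))%:R / (dfact (2 * m + 1))%:R * (r ^+ 2 / (1 + r ^+ 2)) ^+ k.
Proof.
have /andP[x0 _] := ratio_itv r.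
by move=> q0 mk; rewrite ler_wpM2r ?exprn_ge0// coef_le.
Qed.

Lemma is_cvg_expansion r q : 0 <= q ->
  cvgn (series (fun k => coef q k * (r ^+ 2 / (1 + r ^+ 2)) ^+ k)).
Proof.
move=> q0; have /andP[x0 x1] := ratio_itv r.
apply: (@series_le_cvg _ _ (geometric 1 (r ^+ 2 / (1 + r ^+ 2)))).
- by move=> k; exact: expansion_term_ge0.
- by move=> k; rewrite /geometric/= mul1r exprn_ge0.
(* The bound is used from index 0, where the ratio $0!!/1!!$ is 1. *)
- move=> k; apply: (le_trans (expansion_term_le r q0 (leq0n k))).
  by rewrite dfact_odd0 (dfact_even 0) divr1.
- by apply: is_cvg_geometric_series; rewrite ger0_norm.
Qed.

(** The integrals of the partial sums have two limits, one by dominated convergence and one by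
    summing the series; uniqueness equates them. *)
Lemma Phi2_expansion h rho : -1 < rho < 1 ->
  let r := rho / Num.sqrt (1 - rho ^+ 2) in
  let q := 2^-1 * (1 + r ^+ 2) * h ^+ 2 in
  Phi2 rho h 0 = 2^-1 * Phi h + r / (2 * pi * (1 + r ^+ 2)) *
    limn (series (fun k => coef q k * (r ^+ 2 / (1 + r ^+ 2)) ^+ k)).
Proof.
move=> rho1 r q.
have a0 : 0 < 1 + r ^+ 2 by rewrite ltr_pwDl// sqr_ge0.
have q0 : 0 <= q by rewrite mulr_ge0 ?sqr_ge0// mulr_ge0// ltW.
have p0 : (0 : R) < pi by exact: pi_gt0.
have s0 : 0 < Num.sqrt (2 * pi) :> R by rewrite sqrtr_gt0 mulr_gt0.
have s2 : Num.sqrt (2 * pi) ^+ 2 = 2 * pi :> R.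
  by rewrite sqr_sqrtr// mulr_ge0// ltW.
rewrite Phi2_0E// -/r PhiE.
set I := Rintegral _ _ _; set S := limn _.
have I_S : I = gauss_primitive 0 * gauss_primitive h + r / (1 + r ^+ 2) * S.
  apply/eqP; rewrite addrC -subr_eq; apply/eqP.
  have := @cvg_integral_gaussM_sum R r h.
  under eq_fun do rewrite integral_gaussM_sum.
  move=> /cvg_unique; apply; first exact: Rhausdorff.
  by apply: (@cvgM R); [exact: cvg_cst|exact: is_cvg_expansion].
rewrite I_S gauss_primitive0.
move: s0 s2; set s := Num.sqrt _ => s0 s2; clearbody s.
(* [pi] is generalized because [field] would unfold it. *)
move: (pi : R) p0 s2 => p p0 s2.
rewrite mulrDr; congr (_ + _); last by field; rewrite !gt_eqF.
(* The constant term: $(2p)^{-1}\, s/2 = \frac12 s^{-1}$ because $s^2 = 2p$. *)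
by rewrite -s2; field; rewrite gt_eqF.
Qed.

End expansion_convergence.

(** For an integer [n >= -1] the numbers [n + 1], [2 * n + 2] and [2 * n + 3] are nonnegative, so
    their absolute values are the intended natural indices. Each [cvgn] ensures that the
    accompanying [limn] is a genuine sum. *)
Theorem theorem4 (R : realType) :
  (forall h rho : R, -1 < rho < 1 ->
     let r := rho / Num.sqrt (1 - rho ^+ 2) in
     let q := 2^-1 * (1 + r ^+ 2) * h ^+ 2 in
     let u := fun k : nat => coef q k * (r ^+ 2 / (1 + r ^+ 2)) ^+ k in
     let v := fun k : nat => coef q k * rho ^+ (2 * k + 1) in
     [/\ q = h ^+ 2 / (2 * (1 - rho ^+ 2)),
         cvgn (series u) /\
         Phi2 rho h 0 =
           2^-1 * Phi h + r / (2 * pi * (1 + r ^+ 2)) * limn (series u),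
         cvgn (series v) /\
         Phi2 rho h 0 =
           2^-1 * Phi h + Num.sqrt (1 - rho ^+ 2) / (2 * pi) * limn (series v)
       & forall n : int, -1 <= n ->
         let S_n := \sum_(0 <= k < `|(n + 1)%R|%N) u k in
         let R_n := `|r| / (2 * pi * (1 + r ^+ 2)) *
                    limn (fun N => \sum_(`|(n + 1)%R|%N <= k < N) u k) in
         let B_n := (dfact `|(2 * n + 2)%R|%N)%:R / (dfact `|(2 * n + 3)%R|%N)%:R *
                    (`|r| / (2 * pi)) *
                    (r ^+ 2 / (1 + r ^+ 2)) ^+ `|(n + 1)%R|%N in
         Phi2 rho h 0 =
           2^-1 * Phi h + r * S_n / (2 * pi * (1 + r ^+ 2)) + sgn r * R_n
         /\ 0 <= R_n <= B_n]) /\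
  (forall r h : R,
     let q := 2^-1 * (1 + r ^+ 2) * h ^+ 2 in
     cvgn (series (fun k : nat => coef q k * (r ^+ 2 / (1 + r ^+ 2)) ^+ k))).
Proof.
have q_ge0 (r h : R) : 0 <= 2^-1 * (1 + r ^+ 2) * h ^+ 2.
  by rewrite mulr_ge0 ?sqr_ge0// mulr_ge0// addr_ge0 ?sqr_ge0.
split; last by move=> r h q; apply: is_cvg_expansion; exact: q_ge0.
move=> h rho rho1 r q u v.
have p0 : (0 : R) < pi by exact: pi_gt0.
have a0 : 0 < 1 + r ^+ 2 by rewrite ltr_pwDl// sqr_ge0.
have q0 : 0 <= q := q_ge0 r h.
have cu : cvgn (series u) by exact: is_cvg_expansion.
have Phi2u : Phi2 rho h 0 = _ := Phi2_expansion h rho1.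
have rr : 0 < 1 - rho ^+ 2 by case/andP: rho1 => *; nra.
set s := Num.sqrt (1 - rho ^+ 2) in r q u v a0 q0 cu Phi2u *.
have s0 : 0 < s by rewrite sqrtr_gt0.
have s2 : s ^+ 2 = 1 - rho ^+ 2 by rewrite sqr_sqrtr// ltW.
have aE : 1 + r ^+ 2 = (1 - rho ^+ 2)^-1.
  rewrite /r expr_div_n s2; field.
  by rewrite gt_eqF.
have xE : r ^+ 2 / (1 + r ^+ 2) = rho ^+ 2.
  by rewrite aE /r expr_div_n s2; field; rewrite gt_eqF.
(* As the ratio is [rho ^+ 2], each [v k] is [rho * u k], so the second series inherits convergence
   from the first. *)
have vE : series v = fun n => rho * series u n.
  apply/funext => n; rewrite /series/= mulr_sumr; apply: eq_bigr => k _.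
  by rewrite /v /u xE addn1 exprS exprM; ring.
have cv : series v n @[n --> \oo] --> rho * limn (series u).
  by rewrite vE; apply: cvgM => //; exact: cvg_cst.
split.
- by rewrite /q aE; field; rewrite gt_eqF.
- by split.
- split; first exact: cvgP cv.
  rewrite (cvg_lim _ cv)// Phi2u -/u aE -s2 /r; congr (_ + _).
  by move: (pi : R) p0 => p p0; field; rewrite !gt_eqF.
move=> n; rewrite -(subr_ge0 (-1)) opprK => n1 S_n R_n B_n.
(* [m] is the number of terms kept; [n = -1] gives the empty sum. *)
have [m mE] : exists m : nat, n = m%:Z - 1.
  by exists `|(n + 1)%R|%N; rewrite gez0_abs// addrK.
have Em : `|(n + 1)%R|%N = m by rewrite mE subrK.
have E2 : `|(2 * n + 2)%R|%N = (2 * m)%N by rewrite mE; lia.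
have E3 : `|(2 * n + 3)%R|%N = (2 * m + 1)%N by rewrite mE; lia.
rewrite /B_n E2 E3 {}/R_n {}/S_n Em {B_n}; split.
  rewrite Phi2u -/u -/r (cvg_lim _ (@cvg_series_tail _ u m cu))// -addrA.
  congr (_ + _).
  (* [sgn r] times the modulus is [r], also at 0, where [sgn] is 1 but the modulus vanishes. *)
  have -> : sgn r * (`|r| / (2 * pi * (1 + r ^+ 2)) *
      (limn (series u) - \sum_(0 <= k < m) u k)) =
      r / (2 * pi * (1 + r ^+ 2)) * (limn (series u) - \sum_(0 <= k < m) u k).
    rewrite /sgn !mulrA; congr (_ / _ * _).
    case: ifPn => [r0|]; first by rewrite ger0_norm// mul1r.
    by rewrite -ltNge => r0; rewrite ltr0_norm// mulrNN mul1r.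
  ring.
have /andP[t0 t1] : 0 <= limn (fun N => \sum_(m <= k < N) u k) <=
    (dfact (2 * m))%:R / (dfact (2 * m + 1))%:R * (r ^+ 2 / (1 + r ^+ 2)) ^+ m /
    (1 - r ^+ 2 / (1 + r ^+ 2)).
  apply: series_tail_bound => //.
  - exact: ratio_itv.
  - by move=> k; exact: expansion_term_ge0.
  - by move=> k mk; exact: expansion_term_le.
have d0 : 0 <= `|r| / (2 * pi * (1 + r ^+ 2)).
  by rewrite divr_ge0// !mulr_ge0// ltW.
rewrite mulr_ge0//=; apply: (le_trans (ler_wpM2l d0 t1)).
(* The geometric bound is exactly $B_n$: the factor $1/(1-x) = 1+r^2$ cancels the denominator in
   $R_n$. *)
rewrite le_eqVlt; apply/orP; left; apply/eqP.
have -> : 1 - r ^+ 2 / (1 + r ^+ 2) = (1 + r ^+ 2)^-1 by field; rewrite gt_eqF.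
by rewrite invrK; move: (pi : R) p0 => p p0; field; rewrite dfact_neq0 !gt_eqF.
Qed.
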